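(* For every finite poset $P$, the following are equivalent. (a) There is no weak N and no X in $P$; that is, there is no $(a,b,c,d)\in P^4$ forming a weak N and no $(a,b,c,d,m)\in P^5$ forming an X. (b) $P$ has a compatible incomparability orthoset; that is, for all $x,y\in P$ with $x\not\perp y$ there exists $z\in P$ such that $x^\perp\cup y^\perp\subseteq z^\perp$.
   Context: Let $P$ be a poset. Write $x\perp y$ if $x$ and $y$ are incomparable, i.e. neither $x\le y$ nor $y\le x$ (in particular $x\not\perp x$), and let $x^\perp=\{w\in P: w\perp x\}$ be the set of all elements incomparable to $x$. Write $x\prec y$ if $y$ covers $x$, i.e. $x<y$ and there is no $w\in P$ with $x<w<y$. A quadruple $(a,b,c,d)\in P^4$ forms a weak N if $a<c$, $b\prec c$, $b<d$, $a\perp b$ and $c\perp d$. A quintuple $(a,b,c,d,m)\in P^5$ forms an X if $a<m<c$, $b<m<d$, $a\perp b$ and $c\perp d$. A finite poset $P$ has a compatible incomparability orthoset if for all $x,y\in P$ such that $x\not\perp y$, there exists $z\in P$ such that $x^\perp\cup y^\perp\subseteq z^\perp$. *)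

(* Defs.v *)
From mathcomp Require Import all_boot all_order.

Set Implicit Arguments.
Unset Strict Implicit.
Unset Printing Implicit Defensive.

Import Order.TTheory.

Local Open Scope order_scope.

Definition perp {d : Order.disp_t} {P : finPOrderType d} (x : P) : {set P} :=
  [set w | w >< x].

(* The cover relation, read from left to right: [x] is covered by [y]. *)
Definition covered_by {d : Order.disp_t} {P : finPOrderType d} (x y : P) : bool :=
  (x < y) && ~~ [exists w : P, x < w < y].

Definition weakN {d : Order.disp_t} {P : finPOrderType d} (a b c e : P) : bool :=
  [&& a < c, covered_by b c, b < e, a >< b & c >< e].

Definition formX {d : Order.disp_t} {P : finPOrderType d} (a b c e m : P) : bool :=
  [&& a < m < c, b < m < e, a >< b & c >< e].

Definition compatible_incomparability_orthoset {d : Order.disp_t}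
    (P : finPOrderType d) : Prop :=
  forall x y : P, ~~ (x >< y) -> exists z : P, perp x :|: perp y \subset perp z.

(* Main.v *)
(* If neither [perp x] nor [perp y] contains the other, with [x < y], the elements
   of [[x, y]] lying below some [e] incomparable to [y] form a down-set containing
   [x], those lying above some [a] incomparable to [x] form an up-set containing
   [y], and the absence of an X makes the two disjoint.  Crossing a cover directly
   from the first to the second would give a weak N, so some element of [[x, y]]
   avoids both; it is the required [z].  Conversely the orthoset condition at
   [(b, c)] kills a weak N, and in an X with [a] maximal, its instances at [(a, e)]
   and then at [(a, m)] produce a strictly larger [a]. *)
Require Import Defs.
From mathcomp Require Import all_boot all_order.

Import Order.TTheory.

Local Open Scope order_scope.

(** A point of [p] with the most elements strictly below it is maximal, since strict down-sets grow
    strictly along [<]. *)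
Lemma exists_maximal {d : Order.disp_t} {P : finPOrderType d} (p : pred P) (x : P) :
  p x -> exists2 m, p m & forall y, m < y -> ~~ p y.
Proof.
move=> px; case: (@arg_maxnP _ x p (fun z => #|[set w | w < z]|) px) => m pm maxm.
exists m => // y lt_my; apply/negP => /maxm; apply/negP; rewrite -ltnNge.
apply/proper_card/properP; split.
  by apply/subsetP => w; rewrite !inE => /lt_trans; apply.
by exists m; rewrite !inE ?ltxx.
Qed.

Lemma exists_cover_le {d : Order.disp_t} {P : finPOrderType d} (x y : P) :
  x < y -> exists2 z, covered_by x z & z <= y.
Proof.
move=> lt_xy; have pxy : x < y <= y by rewrite lt_xy lexx.
(* Maximal in the dual order [P^d] means minimal in [P]. *)
have [z /andP[lt_xz le_zy] minz] :=
  @exists_maximal _ P^d (fun w : P => x < w <= y) y pxy.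
exists z => //; rewrite /covered_by lt_xz /=; apply/existsPn => w.
apply/negP => /andP[lt_xw lt_wz].
by have := minz w lt_wz; rewrite lt_xw (le_trans (ltW lt_wz) le_zy).
Qed.

Section Incomparability.
Context {d : Order.disp_t} {P : finPOrderType d}.
Implicit Types a b c e m w x y z : P.

Lemma incomparable_nle x y : x >< y -> ~ x <= y.
Proof. by move=> xy le_xy; rewrite /Order.comparable le_xy in xy. Qed.

Lemma incomparable_nge x y : x >< y -> ~ y <= x.
Proof. by rewrite comparable_sym; apply: incomparable_nle. Qed.

Lemma incomparableI x y : ~ x <= y -> ~ y <= x -> x >< y.
Proof. by move=> nxy nyx; apply/negP => /orP[]. Qed.

(** The comparabilities hold because [z] is not in [perp z], hence in neither [perp x] nor
    [perp y]. *)
Lemma orthoset_spec x y : compatible_incomparability_orthoset P -> x <= y ->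
  exists z, [/\ x >=< z, y >=< z, forall w, w >< x -> w >< z
              & forall w, w >< y -> w >< z].
Proof.
move=> orthoP le_xy; have [|z /subsetP sub] := orthoP x y.
  by rewrite negbK le_comparable.
have xz w : w >< x -> w >< z by move=> wx; have := sub w; rewrite !inE wx; apply.
have yz w : w >< y -> w >< z.
  by move=> wy; have := sub w; rewrite !inE wy orbT; apply.
exists z; split=> //; rewrite comparable_sym; apply/negPn/negP.
  by move/xz; rewrite comparablexx.
by move/yz; rewrite comparablexx.
Qed.

(** The orthoset condition at [(b, c)] gives [z] comparable to both; [z <= b] would put [z] below
    [e], and [c <= z] would put it above [a]. *)
Lemma orthoset_between a b c e : compatible_incomparability_orthoset P ->
  a < c -> b < c -> b < e -> a >< b -> c >< e ->
  exists z, [/\ b < z < c, a >< z & e >< z].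
Proof.
move=> orthoP lt_ac lt_bc lt_be ab ce.
have [z [bz cz perp_bz perp_cz]] := orthoset_spec _ _ orthoP (ltW lt_bc).
have az := perp_bz a ab.
have ez : e >< z by apply: perp_cz; rewrite comparable_sym.
exists z; split=> //; apply/andP; split.
  rewrite (comparable_ltNge bz); apply/negP => le_zb.
  by case: (incomparable_nge _ _ ez); apply: le_trans le_zb (ltW lt_be).
rewrite comparable_sym in cz.
rewrite (comparable_ltNge cz); apply/negP => le_cz.
by case: (incomparable_nle _ _ az); apply: le_trans (ltW lt_ac) le_cz.
Qed.

Lemma orthoset_no_weakN a b c e :
  compatible_incomparability_orthoset P -> ~ weakN a b c e.
Proof.
move=> orthoP; case/and5P=> lt_ac /andP[lt_bc /existsPn cover_bc] lt_be ab ce.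
have [z [lt_bzc _ _]] := orthoset_between _ _ _ _ orthoP lt_ac lt_bc lt_be ab ce.
by have := cover_bc z; rewrite lt_bzc.
Qed.

Lemma orthoset_formX_extend a b c e m : compatible_incomparability_orthoset P ->
  formX a b c e m -> exists2 a', a < a' & formX a' b c e m.
Proof.
move=> orthoP; case/and4P=> /andP[lt_am lt_mc] /andP[lt_bm lt_me] ab ce.
have lt_ae := lt_trans lt_am lt_me; have lt_bc := lt_trans lt_bm lt_mc.
have ba : b >< a by rewrite comparable_sym.
have ec : e >< c by rewrite comparable_sym.
(* The N used here is [(b, a, e, c)], whose middle relation is [a < e]. *)
have [u [/andP[lt_au lt_ue] bu cu]] := orthoset_between _ _ _ _ orthoP
  (lt_trans lt_bm lt_me) lt_ae (lt_trans lt_am lt_mc) ba ec.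
have mu : m >< u.
  apply: incomparableI => [le_mu | le_um].
    by case: (incomparable_nle _ _ bu); apply: le_trans (ltW lt_bm) le_mu.
  by case: (incomparable_nge _ _ cu); apply: le_trans le_um (ltW lt_mc).
(* Now [(b, a, m, u)] is an N with middle relation [a < m]. *)
have [a' [/andP[lt_aa' lt_a'm] ba' _]] :=
  orthoset_between _ _ _ _ orthoP lt_bm lt_am lt_au ba mu.
exists a' => //; apply/and4P; split=> //; try by apply/andP.
by rewrite comparable_sym.
Qed.

Lemma orthoset_no_formX a b c e m :
  compatible_incomparability_orthoset P -> ~ formX a b c e m.
Proof.
move=> orthoP Xa.
have [a1 Xa1 max_a1] := exists_maximal (fun a => formX a b c e m) a Xa.
have [a2 lt_a12 Xa2] := orthoset_formX_extend _ _ _ _ _ orthoP Xa1.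
by have := max_a1 a2 lt_a12; rewrite Xa2.
Qed.

(** Anything above [z] is above [x], and anything below [z] is below [y], so the two hypotheses
    exclude the only other comparabilities. *)
Lemma perpU_sub_between x y z : x <= z -> z <= y ->
  (forall a, a >< x -> ~ a <= z) -> (forall e, e >< y -> ~ z <= e) ->
  perp x :|: perp y \subset perp z.
Proof.
move=> le_xz le_zy nA nE; apply/subsetP => w; rewrite !inE.
case/orP=> wxy; apply: incomparableI.
- exact: nA.
- by move=> le_zw; apply: (incomparable_nge _ _ wxy); apply: le_trans le_xz le_zw.
- by move=> le_wz; apply: (incomparable_nle _ _ wxy); apply: le_trans le_wz le_zy.
- exact: nE.
Qed.

Lemma orthoset_le x y :
  (~ exists a b c e : P, weakN a b c e) ->
  (~ exists a b c e m : P, formX a b c e m) ->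
  x <= y -> exists z, perp x :|: perp y \subset perp z.
Proof.
move=> noN noX le_xy.
pose below z := [exists e, (e >< y) && (z <= e)].
have [below_x | /existsPn not_below_x] := boolP (below x); last first.
  exists x; apply: perpU_sub_between => // [a ax | e ey le_xe].
    exact: incomparable_nle.
  by have := not_below_x e; rewrite ey le_xe.
have pxx : [&& x <= x, x <= y & below x] by rewrite lexx le_xy.
(* This [z] is the last point before leaving [below]; the witness will be a cover [t] of [z] inside
   the interval. *)
have [z /and3P[le_xz le_zy /existsP[e /andP[ey le_ze]]] max_z] :=
  exists_maximal (fun z => [&& x <= z, z <= y & below z]) x pxx.
have ye : y >< e by rewrite comparable_sym.
have lt_zy : z < y.
  rewrite lt_neqAle le_zy andbT; apply/eqP => eq_zy.
  by apply: (incomparable_nle _ _ ye); rewrite -eq_zy.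
have lt_ze : z < e.
  rewrite lt_neqAle le_ze andbT; apply/eqP => eq_ze.
  by apply: (incomparable_nle _ _ ey); rewrite -eq_ze.
have nA a : a >< x -> ~ a <= z.
  move=> ax le_az.
  have lt_az : a < z.
    rewrite lt_neqAle le_az andbT; apply/eqP => eq_az.
    by apply: (incomparable_nge _ _ ax); rewrite eq_az.
  have lt_xz : x < z.
    rewrite lt_neqAle le_xz andbT; apply/eqP => eq_xz.
    by apply: (incomparable_nle _ _ ax); rewrite eq_xz.
  apply: noX; exists a, x, y, e, z.
  by rewrite /formX lt_az lt_zy lt_xz lt_ze ax ye.
have [t cov_zt le_ty] := exists_cover_le _ _ lt_zy.
have lt_zt : z < t by case/andP: cov_zt.
have le_xt := le_trans le_xz (ltW lt_zt).
have not_below_t f : f >< y -> ~ t <= f.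
  move=> fy le_tf; have := max_z t lt_zt; rewrite le_xt le_ty /=.
  by move/existsPn/(_ f); rewrite fy le_tf.
(* An [a] incomparable to [x] with [a <= t] would make [(a, z, t, e)] a weak N. *)
exists t; apply: perpU_sub_between => // a ax le_at.
have az : a >< z.
  apply: incomparableI; first exact: nA.
  by move=> le_za; apply: (incomparable_nge _ _ ax); apply: le_trans le_xz le_za.
have lt_at : a < t.
  rewrite lt_neqAle le_at andbT; apply/eqP => eq_at.
  by apply: (incomparable_nge _ _ ax); rewrite eq_at.
have te : t >< e.
  apply: incomparableI; first exact: not_below_t.
  by move=> le_et; apply: (incomparable_nle _ _ ey); apply: le_trans le_et le_ty.
by apply: noN; exists a, z, t, e; rewrite /weakN lt_at cov_zt lt_ze az te.
Qed.

End Incomparability.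

Theorem theorem1 (d : Order.disp_t) (P : finPOrderType d) :
  ((~ exists a b c e : P, weakN a b c e) /\
   (~ exists a b c e m : P, formX a b c e m))
  <-> compatible_incomparability_orthoset P.
Proof.
split=> [[noN noX] x y | orthoP].
  rewrite negbK => /orP[le_xy | le_yx]; first exact: orthoset_le.
  by rewrite setUC; apply: orthoset_le.
split; first by case=> a [b [c [e]]]; apply: orthoset_no_weakN.
by case=> a [b [c [e [m]]]]; apply: orthoset_no_formX.
Qed.
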